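(* Let $G$ be a finite simple graph of order $n$. Suppose there exist positive real constants $\omega, \beta_1, \beta_2, \beta_3, \beta_4$ such that $G$ is alluring with respect to these weights. Then $\iota(G) \le \omega n$.
   Context: For a graph $G$, a set $S \subseteq V(G)$ is an isolating set if $G - N[S]$ has no edge; the isolation number $\iota(G)$ is the minimum size of an isolating set of $G$. Given $D \subseteq V(G)$, the isolation residual graph $G_D^\iota$ has vertex set $V(G)$ and its vertices are colored as follows: a vertex of $V(G)\setminus N[D]$ having a neighbor in $V(G)\setminus N[D]$ is white; a vertex of $N[D]$ having a white neighbor is blue; all other vertices are red. The edge set of $G_D^\iota$ consists of all edges of $G$ incident with at least one white vertex. Given positive constants $\omega,\beta_1,\beta_2,\beta_3,\beta_4$, the weight of a vertex $v$ in $G_D^\iota$ is $\omega$ if $v$ is white, $\beta_i$ if $v$ is blue of degree exactly $i$ in $G_D^\iota$ for $i\in\{1,2,3\}$, $\beta_4$ if $v$ is blue of degree at least $4$ in $G_D^\iota$, and $0$ if $v$ is red; $\mathsf{w}(G_D^\iota)$ is the sum of the weights of all vertices. For $A \subseteq V(G)\setminus D$, let $\xi(A) = \mathsf{w}(G_D^\iota) - \mathsf{w}(G_{D\cup A}^\iota)$; $A$ is $D$-desirable if $\xi(A) \ge |A|$. The graph $G$ is alluring (with respect to the weights) if for every $D \subseteq V(G)$ that is not an isolating set of $G$, there exists a $D$-desirable set $A \subseteq V(G)\setminus D$.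
   Formalization: A D-desirable set A is required to be nonempty; otherwise the empty set, with ξ(∅) = 0 = |∅|, would make every graph alluring for all weights and the claim would fail (e.g. for K_2 with ω < 1/2). *)

(* Defs.v *)
From mathcomp Require Import all_boot all_order all_algebra.
From mathcomp Require Import reals.

Set Implicit Arguments.
Unset Strict Implicit.
Unset Printing Implicit Defensive.

Import Order.TTheory GRing.Theory Num.Theory.
Local Open Scope ring_scope.

(* A finite simple graph is a finType [V] with an adjacency relation
   [e : rel V]; symmetry and irreflexivity are hypotheses of the theorem. *)

Definition closed_nbhd (V : finType) (e : rel V) (S : {set V}) : {set V} :=
  [set v | (v \in S) || [exists u in S, e u v]].

Definition isolating (V : finType) (e : rel V) (S : {set V}) : bool :=
  [forall x, forall y,
    (x \notin closed_nbhd e S) && (y \notin closed_nbhd e S) ==> ~~ e x y].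

(* [setT] is always isolating, so the arg min is taken over a nonempty family. *)
Definition isolation_number (V : finType) (e : rel V) : nat :=
  #|[arg min_(S < [set: V] | isolating e S) #|S|]|.

Definition white (V : finType) (e : rel V) (D : {set V}) (v : V) : bool :=
  (v \notin closed_nbhd e D)
  && [exists u, (u \notin closed_nbhd e D) && e v u].

Definition blue (V : finType) (e : rel V) (D : {set V}) (v : V) : bool :=
  (v \in closed_nbhd e D) && [exists u, white e D u && e v u].

Definition residual (V : finType) (e : rel V) (D : {set V}) : rel V :=
  fun x y => e x y && (white e D x || white e D y).

Definition residual_degree (V : finType) (e : rel V) (D : {set V}) (v : V) :
    nat :=
  #|[set u | residual e D v u]|.

(* The vertices that are neither white nor blue are the red ones. A blue vertex
   has a white neighbor, hence residual degree at least 1: the degree 0 branch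
   is never reached. *)
Definition vertex_weight (R : realType) (w b1 b2 b3 b4 : R)
    (V : finType) (e : rel V) (D : {set V}) (v : V) : R :=
  if white e D v then w
  else if blue e D v then
    match residual_degree e D v with
    | 0%N => 0
    | 1%N => b1
    | 2%N => b2
    | 3%N => b3
    | _ => b4
    end
  else 0.

Definition residual_weight (R : realType) (w b1 b2 b3 b4 : R)
    (V : finType) (e : rel V) (D : {set V}) : R :=
  \sum_(v : V) vertex_weight w b1 b2 b3 b4 e D v.

Definition xi (R : realType) (w b1 b2 b3 b4 : R)
    (V : finType) (e : rel V) (D A : {set V}) : R :=
  residual_weight w b1 b2 b3 b4 e D
  - residual_weight w b1 b2 b3 b4 e (D :|: A).

(* [A] is required to be nonempty: [xi D set0 = 0 = #|set0|], so otherwise the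
   empty set would always be desirable and every graph would be alluring. *)
Definition desirable (R : realType) (w b1 b2 b3 b4 : R)
    (V : finType) (e : rel V) (D A : {set V}) : Prop :=
  [/\ A != set0, A \subset ~: D & #|A|%:R <= xi w b1 b2 b3 b4 e D A].

Definition alluring (R : realType) (w b1 b2 b3 b4 : R)
    (V : finType) (e : rel V) : Prop :=
  forall D : {set V}, ~~ isolating e D ->
    exists A : {set V}, desirable w b1 b2 b3 b4 e D A.

(* Main.v *)
Require Import Defs.
From mathcomp Require Import all_boot all_order all_algebra.
From mathcomp Require Import reals.

Set Implicit Arguments.
Unset Strict Implicit.
Unset Printing Implicit Defensive.

Import Order.TTheory GRing.Theory Num.Theory.
Local Open Scope ring_scope.

(* Adjoining a desirable set to [D] does not increase [#|D|] plus the residual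
   weight, so enlarging the empty set greedily ends with an isolating set whose
   cardinality is at most the residual weight of the empty set. For [D] empty
   no vertex is blue, hence that weight is at most [w * n]. *)

Lemma isolation_number_le (V : finType) (e : rel V) (S : {set V}) :
  isolating e S -> (isolation_number e <= #|S|)%N.
Proof.
move=> isoS; rewrite /isolation_number; case: arg_minnP => [|T _]; last exact.
(* What remains is that the default [[set: V]] is isolating: no vertex lies outside its closed
   neighbourhood. *)
by apply/forallP => x; apply/forallP => y; rewrite !inE.
Qed.

Lemma closed_nbhd0 (V : finType) (e : rel V) : closed_nbhd e set0 = set0.
Proof.
by apply/setP => v; rewrite !inE; apply/existsP => -[u]; rewrite inE.
Qed.

Section ResidualWeight.

Variables (R : realType) (w b1 b2 b3 b4 : R) (V : finType) (e : rel V).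

Local Notation weight := (residual_weight w b1 b2 b3 b4 e).

Lemma residual_weight_ge0 (D : {set V}) :
  0 <= w -> 0 <= b1 -> 0 <= b2 -> 0 <= b3 -> 0 <= b4 -> 0 <= weight D.
Proof.
move=> w0 b10 b20 b30 b40; apply: sumr_ge0 => v _; rewrite /vertex_weight.
by case: ifP => // _; case: ifP => // _; case: residual_degree => [|[|[|[]]]].
Qed.

Lemma residual_weight0_le : 0 <= w -> weight set0 <= w * #|V|%:R.
Proof.
move=> w0; rewrite mulr_natr -sumr_const; apply: ler_sum => v _.
by rewrite /vertex_weight /blue closed_nbhd0 inE; case: ifP.
Qed.

(** The set [D] is arbitrary so that the induction, on the number of vertices outside [D], can pass
    to [D :|: A]. *)
Lemma alluring_isolating_extension (D : {set V}) :
    0 <= w -> 0 <= b1 -> 0 <= b2 -> 0 <= b3 -> 0 <= b4 ->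
    alluring w b1 b2 b3 b4 e ->
  exists2 S : {set V}, isolating e S & #|S|%:R <= #|D|%:R + weight D.
Proof.
move=> w0 b10 b20 b30 b40 allG.
have [m] := ubnP #|~: D|; elim: m D => // m IHm D leDm.
have [isoD | /allG[A [A0 AD leA]]] := boolP (isolating e D).
  (* [D] itself serves as [S], since its residual weight is nonnegative. *)
  by exists D => //; rewrite lerDl residual_weight_ge0.
have disjDA : [disjoint D & A] by rewrite disjoint_sym disjoints_subset.
have cardDA : #|D :|: A| = (#|D| + #|A|)%N.
  by rewrite cardsU disjoint_setI0 // cards0 subn0.
have [|S isoS leS] := IHm (D :|: A).
  (* The complement shrinks strictly: were [A] contained in [D], disjointness would force [A] to be
     empty. *)
  apply: leq_trans (_ : #|~: D| <= m)%N => //; apply: proper_card.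
  rewrite properC properE subsetUl subUset subxx /=.
  by apply: contra A0 => sAD; rewrite -(setIidPr sAD) setI_eq0.
exists S => //; apply: le_trans leS _.
(* After cancelling [#|D|], the inequality left is [leA] with [xi] unfolded. *)
by rewrite cardDA natrD -addrA lerD2l -lerBrDr.
Qed.

End ResidualWeight.

Theorem theorem1 (R : realType) (V : finType) (e : rel V) (n : nat)
  (e_sym : symmetric e) (e_irr : irreflexive e) (card_V : #|V| = n)
  (w b1 b2 b3 b4 : R)
  (w_gt0 : 0 < w) (b1_gt0 : 0 < b1) (b2_gt0 : 0 < b2)
  (b3_gt0 : 0 < b3) (b4_gt0 : 0 < b4)
  (G_alluring : alluring w b1 b2 b3 b4 e) :
  (isolation_number e)%:R <= w * n%:R.
Proof.
have [|||||S isoS leS] := alluring_isolating_extension set0 _ _ _ _ _ G_alluring;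
  do ?exact: ltW.
apply: le_trans (_ : #|S|%:R <= _); first by rewrite ler_nat isolation_number_le.
apply: le_trans leS _; rewrite cards0 add0r -card_V.
exact/residual_weight0_le/ltW.
Qed.
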